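(* Let $a,c\in\mathbb{C}$. Then $$\mathcal{C}\mathrm{Der}(\mathcal{CW}(a,c))=\begin{cases}\mathcal{C}\mathrm{Inn}(\mathcal{CW}(a,c)), & \text{if } a=0 \text{ or } a^{-1}c\notin\mathbb{Z},\\[2pt] \mathcal{C}\mathrm{Inn}(\mathcal{CW}(a,c))\oplus\mathbb{C}\,\mathcal{D}^{\frac{c}{a}}, & \text{if } a\neq0 \text{ and } a^{-1}c\in\mathbb{Z},\end{cases}$$ where $\mathcal{D}^{0}(L_i)=iL_i$ for all $i\in\mathbb{Z}$ (the case $c=0$), and $\mathcal{D}^{\frac{c}{a}}(L_i)=\big(1-\tfrac{a}{c}i\big)L_{i+\frac{c}{a}}$ for all $i\in\mathbb{Z}$ (the case $c\neq0$).
   Context: A Lie conformal algebra is a $\mathbb{C}[\partial]$-module $R$ with a linear map $R\otimes R\to R[\lambda]$, $x\otimes y\mapsto[x\,{}_\lambda\,y]$, such that for all $x,y,z\in R$: $[\partial x\,{}_\lambda\,y]=-\lambda[x\,{}_\lambda\,y]$, $[x\,{}_\lambda\,\partial y]=(\partial+\lambda)[x\,{}_\lambda\,y]$, $[x\,{}_\lambda\,y]=-[y\,{}_{-\lambda-\partial}\,x]$, and $[x\,{}_\lambda\,[y\,{}_\mu\,z]]=[[x\,{}_\lambda\,y]\,{}_{\lambda+\mu}\,z]+[y\,{}_\mu\,[x\,{}_\lambda\,z]]$. For $a,c\in\mathbb{C}$, $\mathcal{CW}(a,c)$ is the Lie conformal algebra that is free as a $\mathbb{C}[\partial]$-module with basis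 $\{L_i\mid i\in\mathbb{Z}\}$ and has $\lambda$-brackets $[L_i\,{}_\lambda\,L_j]=\big((ai+c)\partial+(a(i+j)+2c)\lambda\big)L_{i+j}$ for $i,j\in\mathbb{Z}$. A conformal linear map $D_\lambda:R\to R[\lambda]$ is a $\mathbb{C}$-linear map with $D_\lambda(\partial v)=(\partial+\lambda)D_\lambda(v)$ for all $v\in R$. It is a conformal derivation if $D_\lambda([x\,{}_\mu\,y])=[(D_\lambda x)\,{}_{\lambda+\mu}\,y]+[x\,{}_\mu\,(D_\lambda y)]$ for all $x,y\in R$. It is a conformal inner derivation if $D_\lambda=(\mathrm{ad}_x)_\lambda$ for some $x\in R$, where $(\mathrm{ad}_x)_\lambda\,y=[x\,{}_\lambda\,y]$. One writes $D$ for $D_\lambda$. $\mathcal{C}\mathrm{Der}(R)$ and $\mathcal{C}\mathrm{Inn}(R)$ denote the vector spaces of all conformal derivations and all conformal inner derivations of $R$, respectively. The maps $\mathcal{D}^{\frac{c}{a}}$ are given by their values on the basis elements $L_i$ and extended as conformal linear maps.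
   Formalization: The case a = c = 0 is excluded (the bracket is zero there and the claim fails); for c ≠ 0 the outer derivation is corrected to L_i ↦ (1 + (a/c)i) L_{i−c/a}, since the stated map is not a conformal derivation for the given bracket. *)

(* Defs.v *)
From HB Require Import structures.
From mathcomp Require Import all_boot all_order all_algebra finmap ring.
From mathcomp Require Import monalg.
From mathcomp Require Import boolp classical_sets functions.

Set Implicit Arguments.
Unset Strict Implicit.
Unset Printing Implicit Defensive.

Import GRing.Theory.
Local Open Scope ring_scope.

(* V[lam]: finitely supported sequences of coefficients in V.  When V is an
   A-module, V[lam] is made into an A[lam]-module. *)
Definition lpoly (A : nzRingType) (V : lmodType A) : Type := {malg V[nat]}.

HB.instance Definition _ (A : nzRingType) (V : lmodType A) :=
  GRing.Zmodule.on (lpoly V).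

Section Lpoly.
Context (A : nzRingType) (V : lmodType A).
Implicit Types (p q : {poly A}) (u v : lpoly V).

Definition lcoef v (n : nat) : V := mcoeff n v.
Definition lconst (x : V) : lpoly V := mkmalgU 0%N x.

Definition lscale p v : lpoly V :=
  \sum_(i < size p) \sum_(n <- msupp v) mkmalgU (i + n)%N (p`_i *: v@_n).

Lemma lcoefD n u v : lcoef (u + v) n = lcoef u n + lcoef v n.
Proof. exact: mcoeffD. Qed.

Lemma lcoef_sum n I (r : seq I) (P : pred I) (f : I -> lpoly V) :
  lcoef (\sum_(i <- r | P i) f i) n = \sum_(i <- r | P i) lcoef (f i) n.
Proof. exact: (raddf_sum (mcoeff n)). Qed.

Lemma lscaleE p v n :
  lcoef (lscale p v) n = \sum_(i < n.+1) p`_i *: lcoef v (n - i)%N.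
Proof.
have aux i : lcoef (\sum_(m <- msupp v) mkmalgU (i + m)%N (p`_i *: v@_m)) n
   = if (i <= n)%N then p`_i *: lcoef v (n - i)%N else 0.
  rewrite lcoef_sum; under eq_bigr do rewrite /lcoef mcoeffU.
  case: leqP => hi; last first.
    by apply: big1_seq => m _; case: eqP => // E; move: hi; rewrite -E ltnNge leq_addr.
  have hE (m : nat) : (i + m == n)%N = (m == n - i)%N.
    by rewrite -(eqn_add2l i m) subnKC.
  under eq_bigr do rewrite hE.
  case: (boolP ((n - i)%N \in msupp v)) => hm.
    rewrite (big_fsetD1 _ hm) /= eqxx big1_fset ?addr0 // => m.
    by rewrite !inE => /andP [/negPf-> _].
  rewrite /lcoef mcoeff_outdom // scaler0 big1_seq // => m /= hm'.
  by case: eqP => // E; move: hm; rewrite -E hm'.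
rewrite lcoef_sum; under eq_bigr do rewrite aux.
pose f i := if (i <= n)%N then p`_i *: lcoef v (n - i)%N else 0.
transitivity (\sum_(i < (size p + n.+1)) f i).
  rewrite big_split_ord /= [X in _ = _ + X]big1 ?addr0 // => i _.
  by rewrite /f nth_default ?leq_addr // scale0r if_same.
rewrite addnC big_split_ord /= [X in _ + X]big1 ?addr0 => [|i _].
  by apply: eq_bigr => i _; rewrite /f -ltnS ltn_ord.
by rewrite /f leqNgt leq_addr.
Qed.

Lemma lpolyP u v : (forall n, lcoef u n = lcoef v n) <-> u = v.
Proof. exact: malgP. Qed.

Fact lscaleA p q v : lscale p (lscale q v) = lscale (p * q) v.
Proof.
apply/lpolyP => n; rewrite !lscaleE.
transitivity (\sum_(i < n.+1) \sum_(j < n.+1 | (i <= j)%N)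
    (p`_i * q`_(j - i)) *: lcoef v (n - j)%N).
  apply: eq_bigr => i _; rewrite lscaleE scaler_sumr.
  pose f j := (p`_i * q`_(j - i)) *: lcoef v (n - j)%N.
  transitivity (\sum_(0 <= j < (n - i).+1) f (j + i)%N).
    rewrite big_mkord; apply: eq_bigr => j _.
    by rewrite /f scalerA addnK -subnDA addnC.
  transitivity (\sum_(i <= j < n.+1) f j).
    by rewrite -[in RHS](add0n i) big_addn subSn // -ltnS.
  by rewrite (big_nat_widenl _ 0%N) // big_mkord.
rewrite (exchange_big_dep predT) //=; apply: eq_bigr => j _.
rewrite coefM scaler_suml.
pose f i := (p`_i * q`_(j - i)) *: lcoef v (n - j)%N.
by rewrite (big_ord_widen n.+1 f) //; apply: eq_bigl => i; rewrite ltnS.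
Qed.

Fact lscale1 v : lscale 1 v = v.
Proof.
apply/lpolyP => n; rewrite lscaleE big_ord_recl coef1 scale1r subn0.
by rewrite big1 ?addr0 // => i _; rewrite coef1 scale0r.
Qed.

Fact lscaleDr p u v : lscale p (u + v) = lscale p u + lscale p v.
Proof.
apply/lpolyP => n; rewrite lcoefD !lscaleE -big_split /=.
by apply: eq_bigr => i _; rewrite lcoefD scalerDr.
Qed.

Fact lscaleDl v p q : lscale (p + q) v = lscale p v + lscale q v.
Proof.
apply/lpolyP => n; rewrite lcoefD !lscaleE -big_split /=.
by apply: eq_bigr => i _; rewrite coefD scalerDl.
Qed.

HB.instance Definition _ := GRing.Zmodule_isLmodule.Build {poly A} (lpoly V)
  lscaleA lscale1 lscaleDr lscaleDl.

(* v = \sum_n lam^n v_n is sent to \sum_n s^n f(v_n), s acting on W after f *)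
Definition lsubst (B : nzRingType) (W : lmodType B) (s : B) (f : V -> W) v : W :=
  \sum_(n <- msupp v) s ^+ n *: f (lcoef v n).

End Lpoly.

Section LieConformalAxioms.
Context (F : fieldType) (V : lmodType {poly F}) (br : V -> V -> lpoly V).

(* A C[del]-module is a {poly F}-module.  V[lam] is then a module over
   F[del][lam], and V[lam,mu] := (V[lam])[mu] over F[del][lam][mu]; the index 1
   or 2 is the number of adjoined variables. *)
Definition del : {poly F} := 'X.
Definition del1 : {poly {poly F}} := 'X%:P.
Definition lam1 : {poly {poly F}} := 'X.
Definition lam2 : {poly {poly {poly F}}} := 'X%:P.
Definition mu2 : {poly {poly {poly F}}} := 'X.

(* [x _s y] in V[lam,mu] *)
Definition bracket_at (s : {poly {poly {poly F}}}) (x y : V) : lpoly (lpoly V) :=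
  lsubst s (fun z => lconst (lconst z)) (br x y).

Definition lie_bilinear := forall (k : F) x y z,
  br (k%:P *: x + y) z = k%:P%:P *: br x z + br y z /\
  br z (k%:P *: x + y) = k%:P%:P *: br z x + br z y.

Definition lie_sesquilinear := forall x y,
  br (del *: x) y = - lam1 *: br x y /\
  br x (del *: y) = (del1 + lam1) *: br x y.

Definition lie_skew := forall x y,
  br x y = - lsubst (- lam1 - del1) (@lconst _ V) (br y x).

Definition lie_jacobi := forall x y z,
  lsubst mu2 (fun v => bracket_at lam2 x v) (br y z) =
  lsubst lam2 (fun u => bracket_at (lam2 + mu2) u z) (br x y) +
  lsubst lam2 (fun v => bracket_at mu2 y v) (br x z).

End LieConformalAxioms.

HB.mixin Record isLieConformal (F : fieldType) V of GRing.Lmodule {poly F} V := {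
  lbr : V -> V -> lpoly V;
  lbr_bilinear : lie_bilinear lbr;
  lbr_sesquilinear : lie_sesquilinear lbr;
  lbr_skew : lie_skew lbr;
  lbr_jacobi : lie_jacobi lbr;
}.

HB.structure Definition LieConformal (F : fieldType) :=
  { V of GRing.Lmodule {poly F} V & isLieConformal F V }.

Notation lieConformalType := LieConformal.type.

Section Derivations.
Context (F : fieldType) (V : lieConformalType F).
Local Open Scope classical_set_scope.
Implicit Types D : V -> lpoly V.

Definition conformal_linear D :=
  (forall (k : F) u v, D (k%:P *: u + v) = k%:P%:P *: D u + D v) /\
  (forall v, D (del F *: v) = (del1 F + lam1 F) *: D v).

Definition conformal_derivation D :=
  conformal_linear D /\
  forall x y,
    lsubst (mu2 F) (fun v => lsubst (lam2 F) (fun z => lconst (lconst z)) (D v))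
      (lbr x y) =
    lsubst (lam2 F) (fun u => bracket_at (@lbr F V) (lam2 F + mu2 F) u y) (D x) +
    lsubst (lam2 F) (fun v => bracket_at (@lbr F V) (mu2 F) x v) (D y).

Definition CDer : set (V -> lpoly V) := [set D | conformal_derivation D].

Definition CInn : set (V -> lpoly V) := [set D | exists x, D = lbr x].

Definition Cline D : set (V -> lpoly V) :=
  [set (fun v => k%:P%:P *: D v) | k in [set: F]].

(* A is the internal direct sum of the subspaces B and C. *)
Definition is_direct_sum (A B C : set (V -> lpoly V)) :=
  A = [set D1 \+ D2 | D1 in B & D2 in C] /\ B `&` C = [set cst 0].

End Derivations.
Arguments CDer {F} V.
Arguments CInn {F} V.

Lemma malg_sumD (K : choiceType) (V W : zmodType) (G : K -> V -> W)
    (GD : forall k x y, G k (x + y) = G k x + G k y) (u v : {malg V[K]}) :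
  \sum_(k <- msupp (u + v)) G k (u + v)@_k =
  \sum_(k <- msupp u) G k u@_k + \sum_(k <- msupp v) G k v@_k.
Proof.
have G0 k : G k 0 = 0.
  by apply: (@addrI _ (G k 0)); rewrite -GD !addr0.
have w (d : {fset K}) (x : {malg V[K]}) : fsubset (msupp x) d ->
    \sum_(k <- msupp x) G k x@_k = \sum_(k <- d) G k x@_k.
  by move=> le; apply: big_fset_incl => // k _ /mcoeff_outdom ->.
rewrite (w _ _ (msuppD_le u v)) (w _ _ (fsubsetUl (msupp u) (msupp v))).
rewrite (w _ _ (fsubsetUr (msupp u) (msupp v))) -big_split /=.
by apply: eq_bigr => k _; rewrite mcoeffD GD.
Qed.

Lemma malg_sumU (K : choiceType) (V W : zmodType) (G : K -> V -> W)
    (GD : forall k x y, G k (x + y) = G k x + G k y) (k : K) (x : V) :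
  \sum_(i <- msupp << x *g k >>) G i << x *g k >>@_i = G k x.
Proof.
have G0 i : G i 0 = 0.
  by apply: (@addrI _ (G i 0)); rewrite -GD !addr0.
rewrite (@big_fset_incl _ _ _ _ _ [fset k]%fset) ?msuppU_le //.
  by rewrite big_seq_fset1 mcoeffUU.
by move=> i _ /mcoeff_outdom ->.
Qed.

Section LsubstTheory.
Context (A : nzRingType) (V : lmodType A) (B : comNzRingType) (W : lmodType B).
Context (s : B) (f : V -> W) (fD : forall x y, f (x + y) = f x + f y).

Let GD n x y : s ^+ n *: f (x + y) = s ^+ n *: f x + s ^+ n *: f y.
Proof. by rewrite fD scalerDr. Qed.

Lemma lsubstD u v : lsubst s f (u + v) = lsubst s f u + lsubst s f v.
Proof. exact: (malg_sumD GD). Qed.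

Lemma lsubst0 : lsubst s f 0 = 0.
Proof. by apply: (@addrI _ (lsubst s f 0)); rewrite -lsubstD !addr0. Qed.

Lemma lsubst_sum I (r : seq I) (P : pred I) (g : I -> lpoly V) :
  lsubst s f (\sum_(i <- r | P i) g i) = \sum_(i <- r | P i) lsubst s f (g i).
Proof. exact: (big_morph _ lsubstD lsubst0). Qed.

Lemma lsubst_monom n x : lsubst s f (mkmalgU n x) = s ^+ n *: f x.
Proof. exact: (malg_sumU GD). Qed.

Lemma lscale_const (P : {poly A}) (x : V) :
  P *: lconst x = \sum_(i < size P) (mkmalgU (i : nat) (P`_i *: x) : lpoly V).
Proof.
apply: eq_bigr => i _.
rewrite (malg_sumU (G := fun n y => (mkmalgU (i + n)%N (P`_i *: y) : lpoly V))).
  by rewrite addn0.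
by move=> k y z; rewrite scalerDr monalgUD.
Qed.

Lemma lsubst_scale_const (h : {rmorphism A -> B})
    (fZ : forall a x, f (a *: x) = h a *: f x) P x :
  lsubst s f (P *: lconst x) = (map_poly h P).[s] *: f x.
Proof.
rewrite lscale_const lsubst_sum horner_poly scaler_suml.
by apply: eq_bigr => i _; rewrite lsubst_monom fZ scalerA mulrC.
Qed.
End LsubstTheory.
Arguments lsubst_scale_const {A V B W} s {f} fD h fZ P x.

(* p(s), for p a polynomial in the derivation and s in F[del][lam] *)
Definition peval (F : fieldType) (p : {poly F}) (s : {poly {poly F}}) :
  {poly {poly F}} := (map_poly (polyC \o polyC) p).[s].

(* The parameters are phantom: they select the bracket. *)
Definition CW (F : fieldType) (a c : F) : Type := {malg {poly F}[int]}.

Section CWDef.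
Context (F : fieldType) (a c : F).

HB.instance Definition _ := GRing.Zmodule.on (CW a c).
HB.instance Definition _ := GRing.Lmodule.copy (CW a c) {malg {poly F}[int]}.

Definition Lgen (i : int) : CW a c := mkmalgU i 1.

Definition CW_coef (i j : int) : {poly {poly F}} :=
  (a * i%:~R + c)%:P%:P * del1 F + (a * (i + j)%:~R + 2 * c)%:P%:P * lam1 F.

(* Sesquilinear extension of [L_i _lam L_j] = CW_coef i j L_(i+j):
   [p(del) L_i _lam q(del) L_j] = p(-lam) q(del+lam) [L_i _lam L_j]. *)
Definition CW_br (x y : CW a c) : lpoly (CW a c) :=
  \sum_(i <- msupp x) \sum_(j <- msupp y)
    (peval x@_i (- lam1 F) * peval y@_j (del1 F + lam1 F) * CW_coef i j)
      *: lconst (Lgen (i + j)).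

(* The conformal linear map with values f i on the L_i. *)
Definition conf_ext (f : int -> lpoly (CW a c)) (v : CW a c) : lpoly (CW a c) :=
  \sum_(i <- msupp v) peval v@_i (del1 F + lam1 F) *: f i.

End CWDef.


Section Ev.
Context (F : fieldType) (B : comNzRingType) (e : {rmorphism F -> B}).

Definition ev1 (d : B) (p : {poly F}) : B := (map_poly e p).[d].

Lemma ev1_zmod d : zmod_morphism (ev1 d).
Proof. by move=> p q; rewrite /ev1 rmorphB hornerD hornerN. Qed.
Lemma ev1_monoid d : monoid_morphism (ev1 d).
Proof.
by split=> [|p q]; rewrite /ev1 ?rmorph1 ?hornerC // rmorphM hornerM.
Qed.
HB.instance Definition _ d := GRing.isZmodMorphism.Build _ _ (ev1 d) (ev1_zmod d).
HB.instance Definition _ d := GRing.isMonoidMorphism.Build _ _ (ev1 d) (ev1_monoid d).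

Definition ev2 (d l : B) (P : {poly {poly F}}) : B := (map_poly (ev1 d) P).[l].
Lemma ev2_zmod d l : zmod_morphism (ev2 d l).
Proof. by move=> p q; rewrite /ev2 rmorphB hornerD hornerN. Qed.
Lemma ev2_monoid d l : monoid_morphism (ev2 d l).
Proof.
by split=> [|p q]; rewrite /ev2 ?rmorph1 ?hornerC // rmorphM hornerM.
Qed.
HB.instance Definition _ d l := GRing.isZmodMorphism.Build _ _ (ev2 d l) (ev2_zmod d l).
HB.instance Definition _ d l := GRing.isMonoidMorphism.Build _ _ (ev2 d l) (ev2_monoid d l).

Lemma ev1C d k : ev1 d k%:P = e k.
Proof. by rewrite /ev1 map_polyC hornerC. Qed.
Lemma ev1X d : ev1 d 'X = d.
Proof. by rewrite /ev1 map_polyX hornerX. Qed.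
Lemma ev2C d l p : ev2 d l p%:P = ev1 d p.
Proof. by rewrite /ev2 map_polyC hornerC. Qed.
Lemma ev2X d l : ev2 d l 'X = l.
Proof. by rewrite /ev2 map_polyX hornerX. Qed.

Lemma ev2_peval d l p s : ev2 d l (peval p s) = ev1 (ev2 d l s) p.
Proof.
rewrite /peval /ev1 -(horner_map (ev2 d l)) /=; congr _.[_].
rewrite -map_poly_comp.
by apply: eq_map_poly => k /=; rewrite ev2C ev1C.
Qed.
Lemma ev2_Nlam d l : ev2 d l (- lam1 F) = - l.
Proof. by rewrite (rmorphN (ev2 d l)); congr (- _); apply: ev2X. Qed.

Lemma ev2_dellam d l : ev2 d l (del1 F + lam1 F) = d + l.
Proof.
rewrite (rmorphD (ev2 d l)); congr (_ + _); last exact: ev2X.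
by rewrite -[RHS](ev1X d); apply: ev2C.
Qed.
End Ev.

Section CWTheory.
Context (F : fieldType) (a c : F).
Local Notation CW := (CW a c).
Local Notation del1 := (del1 F).
Local Notation lam1 := (lam1 F).
Local Notation del2 := ('X%:P%:P : {poly {poly {poly F}}}).
Local Notation lam2 := (lam2 F).
Local Notation mu2 := (mu2 F).
Let e1 : {rmorphism F -> {poly {poly F}}} := polyC \o polyC.
Let e2 : {rmorphism F -> {poly {poly {poly F}}}} := polyC \o (polyC \o polyC).
Local Notation U := (fun i p => mkmalgU i p : CW).

Lemma pevalD p q s : peval (p + q) s = peval p s + peval q s :> {poly {poly F}}.
Proof. exact: (rmorphD (ev1 e1 s)). Qed.
Lemma pevalM p q s : peval (p * q) s = peval p s * peval q s :> {poly {poly F}}.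
Proof. exact: (rmorphM (ev1 e1 s)). Qed.

Lemma lconstD (A : nzRingType) (V : lmodType A) (x y : V) :
  lconst (x + y) = lconst x + lconst y.
Proof. exact: monalgUD. Qed.

Lemma CW_U i p : U i p = p *: Lgen a c i.
Proof. by apply/malgP => j; rewrite mcoeffZ !mcoeffU mulrnAr mulr1. Qed.

Lemma CW_ind (P : CW -> Prop) :
  (forall x y, P x -> P y -> P (x + y)) -> (forall i p, P (p *: Lgen a c i)) ->
  forall x, P x.
Proof.
move=> PD PU x; rewrite [x]monalgE; apply: (big_ind P) => //.
  by have := PU 0 0; rewrite scale0r.
by move=> i _; have := PU i x@_i; rewrite -CW_U.
Qed.

Lemma lconstZ (A : nzRingType) (V : lmodType A) r (z : V) :
  lconst (r *: z) = r%:P *: lconst z.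
Proof.
rewrite lscale_const size_polyC; case: eqP => [->|_].
  by rewrite scale0r big_ord0; apply: monalgU0.
by rewrite big_ord1 coefC.
Qed.

Lemma ev1_del1 r : ev1 e1 del1 r = r%:P.
Proof. by rewrite /ev1 map_poly_comp horner_map -/(_ \Po _) comp_polyXr. Qed.

Lemma ev1_del2 r : ev1 e2 del2 r = r%:P%:P.
Proof. by rewrite /ev1 map_poly_comp horner_map; congr (_%:P); apply: ev1_del1. Qed.

Lemma CW_coef_ev2 (B : comNzRingType) (e : {rmorphism F -> B}) d l i j :
  ev2 e d l (CW_coef a c i j) =
  (e a * i%:~R + e c) * d + (e a * (i + j)%:~R + 2 * e c) * l.
Proof.
rewrite /CW_coef rmorphD !rmorphM /= !(ev2C, ev2X, ev1C, ev1X).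
by rewrite !(rmorphD, rmorphM, rmorph_int, rmorph_nat).
Qed.

Lemma CW_coefE i j : CW_coef a c i j =
  (e1 a * i%:~R + e1 c) * del1 + (e1 a * (i + j)%:~R + 2 * e1 c) * lam1.
Proof.
by rewrite /CW_coef /e1 /= !(polyCD, polyCM) !(rmorph_int, rmorph_nat).
Qed.

Let G2 (y : CW) i (p : {poly F}) : lpoly CW := \sum_(j <- msupp y)
    (peval p (- lam1) * peval y@_j (del1 + lam1) * CW_coef a c i j)
      *: lconst (Lgen a c (i + j)).

Let G2D y i p q : G2 y i (p + q) = G2 y i p + G2 y i q.
Proof.
rewrite -big_split; apply: eq_bigr => j _.
by rewrite /= -scalerDl -!mulrDl pevalD.
Qed.

Let G1 i (p : {poly F}) j (q : {poly F}) : lpoly CW :=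
    (peval p (- lam1) * peval q (del1 + lam1) * CW_coef a c i j)
      *: lconst (Lgen a c (i + j)).

Let G1D i p j q r : G1 i p j (q + r) = G1 i p j q + G1 i p j r.
Proof. by rewrite /G1 pevalD -scalerDl -mulrDl -mulrDr. Qed.

Lemma CW_brDl x y z : CW_br (x + y) z = CW_br x z + CW_br y z :> lpoly CW.
Proof. exact: (malg_sumD (G2D z)). Qed.

Lemma CW_brDr x y z : CW_br z (x + y) = CW_br z x + CW_br z y :> lpoly CW.
Proof.
rewrite -big_split; apply: eq_bigr => i _.
exact: (malg_sumD (@G1D i z@_i)).
Qed.

Lemma CW_brU i p j q : CW_br (p *: Lgen a c i) (q *: Lgen a c j) =
    (peval p (- lam1) * peval q (del1 + lam1) * CW_coef a c i j)
      *: lconst (Lgen a c (i + j)).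
Proof.
rewrite -!CW_U [LHS](malg_sumU (G2D _)).
exact: (malg_sumU (@G1D i p)).
Qed.

Local Opaque CW_br Lgen CW_coef peval.

Lemma CW_brZl w x y : CW_br (w *: x) y = peval w (- lam1) *: CW_br x y :> lpoly CW.
Proof.
elim/CW_ind: x => [x x' IH IH'|i p].
  by rewrite (scalerDr w) (CW_brDl (w *: x)) (CW_brDl x) IH IH' [RHS]scalerDr.
elim/CW_ind: y => [y y' IH IH'|j q].
  by rewrite (CW_brDr y y' (w *: (p *: Lgen a c i))) (CW_brDr y y' (p *: Lgen a c i)) IH IH' [RHS]scalerDr.
by rewrite scalerA !CW_brU scalerA pevalM !mulrA.
Qed.

Lemma CW_brZr w x y : CW_br x (w *: y) = peval w (del1 + lam1) *: CW_br x y :> lpoly CW.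
Proof.
elim/CW_ind: x => [x x' IH IH'|i p].
  by rewrite (CW_brDl x x' (w *: y)) (CW_brDl x x' y) IH IH' [RHS]scalerDr.
elim/CW_ind: y => [y y' IH IH'|j q].
  by rewrite (scalerDr w) (CW_brDr (w *: y)) (CW_brDr y) IH IH' [RHS]scalerDr.
by rewrite scalerA !CW_brU scalerA pevalM; congr (_ *: _); ring.
Qed.

Lemma pevalC k s : peval k%:P s = k%:P%:P :> {poly {poly F}}.
Proof. exact: (ev1C e1). Qed.
Lemma pevalX s : peval 'X s = s :> {poly {poly F}}.
Proof. exact: (ev1X e1). Qed.

Fact CW_bilinear : lie_bilinear (@CW_br F a c).
Proof. by move=> k x y z; rewrite CW_brDl CW_brDr CW_brZl CW_brZr !pevalC. Qed.

Fact CW_sesquilinear : lie_sesquilinear (@CW_br F a c).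
Proof. by move=> x y; rewrite CW_brZl CW_brZr !pevalX. Qed.

Fact CW_skew : lie_skew (@CW_br F a c).
Proof.
have cD := @lconstD _ CW.
move=> x y; elim/CW_ind: x => [x x' IH IH'|i p].
  by rewrite CW_brDl CW_brDr IH IH' lsubstD // opprD.
elim/CW_ind: y => [y y' IH IH'|j q].
  by rewrite CW_brDl CW_brDr IH IH' lsubstD // opprD.
rewrite !CW_brU (lsubst_scale_const _ _ (ev1 e1 del1) _) //; last first.
  by move=> r z; rewrite /= ev1_del1 lconstZ.
rewrite -scaleNr (addrC j); congr (_ *: _).
rewrite -/(ev2 e1 del1 _ _) !rmorphM /= !ev2_peval CW_coef_ev2.
rewrite ev2_Nlam ev2_dellam.
rewrite (_ : del1 + (- lam1 - del1) = - lam1); last by ring.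
rewrite (_ : - (- lam1 - del1) = del1 + lam1); last by ring.
rewrite CW_coefE.
rewrite -[peval p _]/(ev1 e1 _ p) -[peval q _]/(ev1 e1 _ q).
set A1 := ev1 e1 _ p; set A2 := ev1 e1 _ q.
rewrite !intrD; move: A1 A2 (e1 a) (e1 c) (i%:~R) (j%:~R) del1 lam1.
move=> A1 A2 ea ec i' j' d l. ring.
Qed.

Let cc (z : CW) : lpoly (lpoly CW) := lconst (lconst z).
Let ccD x y : cc (x + y) = cc x + cc y.
Proof. by rewrite /cc !lconstD. Qed.
Let ccZ r z : cc (r *: z) = ev1 e2 del2 r *: cc z.
Proof. by rewrite ev1_del2 /cc !lconstZ. Qed.

Lemma bracket_atDl s x y z : bracket_at (@CW_br F a c) s (x + y) z =
  bracket_at (@CW_br F a c) s x z + bracket_at (@CW_br F a c) s y z.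
Proof. by rewrite /bracket_at CW_brDl lsubstD. Qed.

Lemma bracket_atDr s x y z : bracket_at (@CW_br F a c) s z (x + y) =
  bracket_at (@CW_br F a c) s z x + bracket_at (@CW_br F a c) s z y.
Proof. by rewrite /bracket_at CW_brDr lsubstD. Qed.

Lemma bracket_atU s i p j q :
  bracket_at (@CW_br F a c) s (p *: Lgen a c i) (q *: Lgen a c j) =
  (ev1 e2 (- s) p * ev1 e2 (del2 + s) q * 
   ev2 e2 del2 s (CW_coef a c i j)) *: cc (Lgen a c (i + j)).
Proof.
rewrite /bracket_at CW_brU (lsubst_scale_const _ _ (ev1 e2 del2) _) //.
rewrite -/(ev2 _ _ _ _) !rmorphM /= !ev2_peval.
by rewrite ev2_Nlam ev2_dellam.
Qed.

Lemma bracket_atZl s w x y : bracket_at (@CW_br F a c) s (w *: x) y =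
  ev1 e2 (- s) w *: bracket_at (@CW_br F a c) s x y.
Proof.
elim/CW_ind: x => [x x' IH IH'|i p].
  by rewrite (scalerDr w) (bracket_atDl s (w *: x)) (bracket_atDl s x) IH IH' [RHS]scalerDr.
elim/CW_ind: y => [y y' IH IH'|j q].
  by rewrite (bracket_atDr s y y' (w *: (p *: Lgen a c i))) (bracket_atDr s y y' (p *: Lgen a c i)) IH IH' [RHS]scalerDr.
by rewrite scalerA !bracket_atU scalerA rmorphM !mulrA.
Qed.

Lemma bracket_atZr s w x y : bracket_at (@CW_br F a c) s x (w *: y) =
  ev1 e2 (del2 + s) w *: bracket_at (@CW_br F a c) s x y.
Proof.
elim/CW_ind: x => [x x' IH IH'|i p].
  by rewrite (bracket_atDl s x x' (w *: y)) (bracket_atDl s x x' y) IH IH' [RHS]scalerDr.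
elim/CW_ind: y => [y y' IH IH'|j q].
  by rewrite (scalerDr w) (bracket_atDr s (w *: y)) (bracket_atDr s y) IH IH' [RHS]scalerDr.
by rewrite scalerA !bracket_atU scalerA rmorphM mulrCA !mulrA.
Qed.

Let lsubst_funD (A : nzRingType) (V : lmodType A) (B : nzRingType)
   (W : lmodType B) (s : B) (f g : V -> W) v :
  lsubst s (fun x => f x + g x) v = lsubst s f v + lsubst s g v.
Proof. by rewrite -big_split; apply: eq_bigr => n _; rewrite scalerDr. Qed.

Let eq_lsubst (A : nzRingType) (V : lmodType A) (B : nzRingType)
   (W : lmodType B) (s : B) (f g : V -> W) v :
  f =1 g -> lsubst s f v = lsubst s g v.
Proof. by move=> E; apply: eq_bigr => n _; rewrite E. Qed.

Let cf (d l : {poly {poly {poly F}}}) (i j : int) : {poly {poly {poly F}}} :=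
  (e2 a * i%:~R + e2 c) * d + (e2 a * (i + j)%:~R + 2 * e2 c) * l.

Let L1 i : Lgen a c i = 1 *: Lgen a c i.
Proof. by rewrite scale1r. Qed.

Let lsubst_bracketr s t i j k p q r :
  lsubst t (fun v => bracket_at (@CW_br F a c) s (p *: Lgen a c i) v)
    (CW_br (q *: Lgen a c j) (r *: Lgen a c k)) =
  (ev1 e2 (- t) q * ev1 e2 (del2 + s + t) r * cf (del2 + s) t j k *
     (ev1 e2 (- s) p * cf del2 s i (j + k))) *: cc (Lgen a c (i + (j + k))).
Proof.
apply: (etrans (congr1 (lsubst _ _) (CW_brU _ _ _ _))).
apply: (etrans (lsubst_scale_const _ _ (ev1 e2 (del2 + s)) _ _ _)).
- by move=> v w; apply: bracket_atDr.
- by move=> v w; apply: bracket_atZr.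
rewrite (L1 (j + k)) bracket_atU scalerA -/(ev2 _ _ _ _); congr (_ *: _).
rewrite 2!(rmorphM (ev2 e2 (del2 + s) t)) /= 2!ev2_peval ev2_Nlam ev2_dellam.
have E : ev1 e2 (del2 + s) 1 = 1 by exact: rmorph1.
by rewrite 2!CW_coef_ev2 E mulr1.
Qed.

Let lsubst_bracketl s t i j k p q r :
  lsubst t (fun u => bracket_at (@CW_br F a c) s u (r *: Lgen a c k))
    (CW_br (p *: Lgen a c i) (q *: Lgen a c j)) =
  (ev1 e2 (- t) p * ev1 e2 (- s + t) q * cf (- s) t i j *
     (ev1 e2 (del2 + s) r * cf del2 s (i + j) k)) *: cc (Lgen a c (i + j + k)).
Proof.
apply: (etrans (congr1 (lsubst _ _) (CW_brU _ _ _ _))).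
apply: (etrans (lsubst_scale_const _ _ (ev1 e2 (- s)) _ _ _)).
- by move=> v w; apply: bracket_atDl.
- by move=> v w; apply: bracket_atZl.
rewrite (L1 (i + j)) bracket_atU scalerA -/(ev2 _ _ _ _); congr (_ *: _).
rewrite 2!(rmorphM (ev2 e2 (- s) t)) /= 2!ev2_peval ev2_Nlam ev2_dellam.
have E : ev1 e2 (- s) 1 = 1 by exact: rmorph1.
rewrite 2!CW_coef_ev2 E.
by apply: congr1; apply: (congr1 (fun u => u * _)); apply: mul1r.
Qed.

Fact CW_jacobi : lie_jacobi (@CW_br F a c).
Proof.
move=> x y z.
have bDl s' u : {morph (fun v => bracket_at (@CW_br F a c) s' v u) : v w / v + w}.
  by move=> v w; apply: bracket_atDl.
have bDr s' u : {morph bracket_at (@CW_br F a c) s' u : v w / v + w}.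
  by move=> v w; apply: bracket_atDr.
elim/CW_ind: x => [x x' IH IH'|i p].
  apply: (etrans (eq_lsubst _ _ (fun v => bracket_atDl _ _ _ _))).
  apply: (etrans (lsubst_funD _ _ _ _)).
  apply: (etrans (congr2 +%R IH IH')); rewrite addrACA; congr (_ + _).
    apply/esym; apply: (etrans (congr1 (lsubst _ _) (CW_brDl x x' y))); apply: lsubstD; exact: bDl.
  apply/esym; apply: (etrans (congr1 (lsubst _ _) (CW_brDl x x' z))); apply: lsubstD; exact: bDr.
elim/CW_ind: y => [y y' IH IH'|j q].
  apply: (etrans (congr1 (lsubst _ _) (CW_brDl y y' z))).
  apply: (etrans (lsubstD _ (bDr _ _) _ _)).
  apply: (etrans (congr2 +%R IH IH')); rewrite addrACA; congr (_ + _).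
    apply/esym; apply: (etrans (congr1 (lsubst _ _) (CW_brDr y y' _))); apply: lsubstD; exact: bDl.
  apply/esym; apply: (etrans _ (lsubst_funD _ _ _ _)); apply: eq_lsubst => v; exact: bracket_atDl.
elim/CW_ind: z => [z z' IH IH'|k r].
  apply: (etrans (congr1 (lsubst _ _) (CW_brDr z z' _))).
  apply: (etrans (lsubstD _ (bDr _ _) _ _)).
  apply: (etrans (congr2 +%R IH IH')); rewrite addrACA; congr (_ + _).
    apply/esym; apply: (etrans _ (lsubst_funD _ _ _ _)); apply: eq_lsubst => v; exact: bracket_atDr.
  apply/esym; apply: (etrans (congr1 (lsubst _ _) (CW_brDr z z' _))); apply: lsubstD; exact: bDr.
apply: (etrans (lsubst_bracketr _ _ _ _ _ _ _ _)); apply/esym.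
apply: (etrans (congr2 +%R (lsubst_bracketl _ _ _ _ _ _ _ _)
  (lsubst_bracketr _ _ _ _ _ _ _ _))).
rewrite -[i + j + k]addrA [j + (i + k)]addrCA -scalerDl; congr (_ *: _).
rewrite /cf !intrD.
move: (e2 a) (e2 c) (i%:~R) (j%:~R) (k%:~R) => ea ec i' j' k'.
rewrite (_ : del2 + mu2 + lam2 = del2 + lam2 + mu2); last by rewrite addrAC.
rewrite (_ : del2 + (lam2 + mu2) = del2 + lam2 + mu2); last by rewrite addrA.
rewrite (_ : - (lam2 + mu2) + lam2 = - mu2); last by rewrite opprD addrAC addNr add0r.
move: (ev1 e2 _ p) (ev1 e2 _ q) (ev1 e2 _ r) => p' q' r'.
move: del2 lam2 mu2 => d l m.
ring.
Qed.
End CWTheory.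

HB.instance Definition _ (F : fieldType) (a c : F) :=
  isLieConformal.Build F (CW a c) (@CW_bilinear F a c) (@CW_sesquilinear F a c)
    (@CW_skew F a c) (@CW_jacobi F a c).

(* The outer derivation, for n = c / a.  With the bracket of CW above, the map
   L_i |-> (1 - (a/c) i) L_(i + c/a) is not a conformal derivation when c != 0:
   at x = y = L_0 the coefficients of lam in the derivation rule are c and 3c.
   The outer derivation is the map with c replaced by -c, which is, up to a
   scalar, the inner derivation of L_(- c/a) divided by lam. *)
Definition calD (F : fieldType) (a c : F) (n : int) : CW a c -> lpoly (CW a c) :=
  conf_ext (fun i =>
    if c == 0 then lconst (i%:~R%:P *: Lgen a c i)
    else lconst ((1 + a / c * i%:~R)%:P *: Lgen a c (i - n))).

(* Main.v *)
Require Import Defs.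
From mathcomp Require Import all_boot all_order all_algebra finmap ring.
From mathcomp Require Import monalg.
From mathcomp Require Import boolp classical_sets reals.
From mathcomp.real_closed Require Import complex.

(** The key fact is that every conformal derivation D of CW(a, c) becomes inner
    after multiplication by lambda: there is x with
    lambda D_lambda(v) = [x _lambda v] for all v (derivation_lam_ad).

    At mu = 0 the derivation rule for L_i and v reads
    (a i + c) (del + lambda) D(S^i v) = [x_i _lambda v] + (a i + c) del S^i D(v),
    where S is the shift L_j |-> L_(j + 1) and x_i is the value of D(L_i) at
    lambda = - del (derivation_shift).  If c != 0, the case i = 0 is the claim
    with x = x_0 / c.  If c = 0 and a != 0, the cases i = 1 and i = -1 are two
    linear relations between D(L_j) and S^-1 D(L_(j + 1)).  Specializing them at
    lambda = - del shows that x_1 = a S y and x_(-1) = - a S^-1 y for one element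
    y, and eliminating D(L_(j + 1)) gives
    lambda (lambda + 2 del) D(L_j) = (lambda + 2 del) [y _lambda L_j], where the
    factor lambda + 2 del cancels.  As x is read off from finitely many values of
    D, it is a finite combination of the L_i, although D may a priori have
    infinitely many homogeneous components.

    Conversely, the derivation rule may be divided by lambda, so every map D with
    lambda D = ad x is a derivation.  It remains to see which ad x are divisible
    by lambda.  At lambda = 0 the equation forces the constant term k_i of the
    coefficient of L_i in x to satisfy k_i (a i + c) = 0.  If a i + c never
    vanishes, x = del q and D = - ad q is inner.  If c = a n with a != 0, then
    x = k L_(-n) + del q, and ad L_(-n) / lambda is a nonzero multiple of the
    outer derivation.  The sum is direct: at lambda = 0, inner derivations have
    no component that shifts indices by - n. *)

Set Implicit Arguments.
Unset Strict Implicit.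
Unset Printing Implicit Defensive.

Import GRing.Theory.
Local Open Scope ring_scope.

(** * Polynomials in lambda with coefficients in a module *)

Section LambdaPolynomials.
Context (A : nzRingType) (V : lmodType A).
Implicit Types (u v : lpoly V) (p : {poly A}).

Lemma lcoef0 n : lcoef (0 : lpoly V) n = 0.
Proof. exact: mcoeff0. Qed.

Lemma lcoef_lconst0 (x : V) : lcoef (lconst x) 0%N = x.
Proof. exact: mcoeffUU. Qed.

Lemma lscale_coef0 p v : lcoef (p *: v) 0%N = p`_0 *: lcoef v 0%N.
Proof. by rewrite lscaleE big_ord1. Qed.

Lemma lscaleC_coef (r : A) v n : lcoef (r%:P *: v) n = r *: lcoef v n.
Proof.
rewrite lscaleE big_ord_recl coefC subn0 big1 ?addr0 // => i _.
by rewrite coefC scale0r.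
Qed.

Lemma lscaleX_coefS v n : lcoef ('X *: v) n.+1 = lcoef v n.
Proof.
rewrite lscaleE big_ord_recl coefX scale0r add0r big_ord_recl coefX scale1r.
rewrite subSS subn0 big1 ?addr0 // => i _.
by rewrite coefX scale0r.
Qed.

Lemma lscaleXn_const n (x : V) : 'X^n *: lconst x = mkmalgU n x.
Proof.
elim: n => [|n IH]; first by rewrite expr0 scale1r.
rewrite exprS -scalerA IH; apply/lpolyP => -[|m].
  by rewrite lscale_coef0 coefX scale0r /lcoef mcoeffU.
by rewrite lscaleX_coefS /lcoef !mcoeffU.
Qed.

Lemma lpoly_ind (P : lpoly V -> Prop) :
  (forall u v, P u -> P v -> P (u + v)) ->
  (forall p x, P (p *: lconst x)) -> forall v, P v.
Proof.
move=> PD PU v; rewrite [v]monalgE; apply: (big_ind P) => //.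
  by have := PU 0 0; rewrite scale0r.
by move=> n _; rewrite -lscaleXn_const; apply: PU.
Qed.

(** A polynomial that is monic in lambda kills nothing, whatever the torsion of
    the coefficient module: look at the top coefficient. *)
Lemma lscale_linear_inj (r : A) : injective (fun v => ('X + r%:P) *: v).
Proof.
move=> u v /eqP; rewrite -subr_eq0 -scalerBr => /eqP E.
apply/eqP; rewrite -subr_eq0; apply/eqP; move: (u - v) E => w E.
(* Descending induction from beyond the degree of w. *)
have step n : lcoef w n.+1 = 0 -> lcoef w n = 0.
  move=> w0; have := congr1 (fun u => lcoef u n.+1) E.
  by rewrite scalerDl lcoefD lscaleX_coefS lscaleC_coef w0 scaler0 addr0 lcoef0.
have [N wN] : exists N, forall n, (N <= n)%N -> lcoef w n = 0.
  exists (\max_(n <- msupp w) n).+1 => n ltn.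
  apply: mcoeff_outdom; apply/negP => nw.
  by move: ltn; rewrite ltnNge (@leq_bigmax_seq _ _ predT id _ nw isT).
have down k n : (N <= n + k)%N -> lcoef w n = 0.
  elim: k n => [|k IH] n; first by rewrite addn0; apply: wN.
  by rewrite addnS -addSn => /IH /step.
by apply/lpolyP => n; rewrite lcoef0 (down N) // leq_addl.
Qed.

Lemma lscaleX_inj : injective (fun v => 'X *: v).
Proof. by have := @lscale_linear_inj 0; rewrite polyC0 addr0. Qed.

Lemma lscaleC_inj (r : A) : injective (fun x : V => r *: x) ->
  injective (fun v => r%:P *: v).
Proof.
by move=> rI u v /= uv; apply/lpolyP => n; apply: rI; rewrite -!lscaleC_coef uv.
Qed.
End LambdaPolynomials.

Section Substitution.
Context (A : nzRingType) (V : lmodType A) (B : comNzRingType).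

Lemma lsubst_ext (W : lmodType B) (s : B) (f g : V -> W) v :
  f =1 g -> lsubst s f v = lsubst s g v.
Proof. by move=> fg; apply: eq_bigr => n _; rewrite fg. Qed.

Lemma lsubst_scale (W : lmodType B) (s : B) (f : V -> W) (h : {rmorphism A -> B}) :
  (forall x y, f (x + y) = f x + f y) -> (forall r x, f (r *: x) = h r *: f x) ->
  forall p v, lsubst s f (p *: v) = (map_poly h p).[s] *: lsubst s f v.
Proof.
move=> fD fZ p; elim/lpoly_ind => [u v IHu IHv|q x].
  by rewrite scalerDr !lsubstD // IHu IHv scalerDr.
by rewrite scalerA !(lsubst_scale_const _ _ h) // rmorphM hornerM scalerA.
Qed.

Lemma lsubst_scaleX (W : lmodType B) (s : B) (f : V -> W) :
  (forall x y, f (x + y) = f x + f y) ->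
  forall v, lsubst s f ('X *: v) = s *: lsubst s f v.
Proof.
move=> fD v; rewrite [v]monalgE scaler_sumr !lsubst_sum // scaler_sumr.
apply: eq_bigr => n _; rewrite -lscaleXn_const scalerA -exprS !lscaleXn_const.
by rewrite !lsubst_monom // exprS scalerA.
Qed.

(** Substituting s for the variable of v and then setting the new variable to 0
    amounts to substituting s at 0; this is how mu is set to 0 below. *)
Lemma lcoef0_lsubst (W : lmodType B) (s : {poly B}) (f : V -> lpoly W) v :
  lcoef (lsubst s f v) 0%N = lsubst s`_0 (fun x => lcoef (f x) 0%N) v.
Proof.
rewrite lcoef_sum; apply: eq_bigr => n _; rewrite lscale_coef0.
by rewrite -!horner_coef0 horner_exp.
Qed.

Lemma lsubst_at0 (W : lmodType B) (f : V -> W) v :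
  f 0 = 0 -> lsubst 0 f v = f (lcoef v 0%N).
Proof.
move=> f0; rewrite /lsubst.
case: (boolP (0%N \in msupp v)) => hv; last first.
  rewrite [in RHS]/lcoef mcoeff_outdom // f0 big1_seq // => n /= nv.
  case: n nv => [h0|n _]; first by rewrite h0 in hv.
  by rewrite expr0n scale0r.
rewrite (big_fsetD1 _ hv) /= expr0 scale1r big1_fset ?addr0 // => n.
by rewrite !inE => /andP [n0 _] _; rewrite expr0n (negPf n0) scale0r.
Qed.
End Substitution.
Arguments lsubst_scale {A V B W s f} h fD fZ p v.

Definition lmap {F : fieldType} {V : lmodType {poly F}} (f : V -> V) :=
  lsubst (lam1 F) (fun x => lconst (f x)).

(** Specialization at lambda = - del, the derivation acting after the
    coefficients.  Powers of lambda in front of a bracket are absorbed this way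
    into its left entry: lambda [x _lambda y] = [- del x _lambda y]. *)
Definition eval_Ndel {F : fieldType} {V : lmodType {poly F}} : lpoly V -> V :=
  lsubst (- del F) id.

Section CoefficientwiseMaps.
Context (F : fieldType) (V : lmodType {poly F}).

Lemma lmapE (f : V -> V) v n : f 0 = 0 -> lcoef (lmap f v) n = f (lcoef v n).
Proof.
move=> f0; rewrite /lmap /lsubst lcoef_sum.
under eq_bigr => m _ do rewrite lscaleXn_const /lcoef mcoeffU.
case: (boolP (n \in msupp v)) => hv; last first.
  rewrite [in RHS]/lcoef mcoeff_outdom // f0 big1_seq // => m /= mv.
  by case: eqP mv => // ->; rewrite (negPf hv).
rewrite (big_fsetD1 _ hv) /= eqxx big1_fset ?addr0 // => m.
by rewrite !inE => /andP [/negPf-> _].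
Qed.

Lemma lmap_id v : lsubst (lam1 F) (@lconst _ V) v = v.
Proof. by apply/lpolyP => n; apply: (lmapE (f := id)). Qed.

Lemma eval_NdelD (u v : lpoly V) : eval_Ndel (u + v) = eval_Ndel u + eval_Ndel v.
Proof. exact: lsubstD. Qed.

Lemma eval_NdelZ P (v : lpoly V) : eval_Ndel (P *: v) = P.[- 'X] *: eval_Ndel v.
Proof. by rewrite /eval_Ndel (lsubst_scale idfun) // map_poly_id. Qed.

Lemma eval_Ndel_lconst (x : V) : eval_Ndel (lconst x) = x.
Proof. by rewrite /eval_Ndel lsubst_monom // expr0 scale1r. Qed.

Lemma eval_Ndel_lsubst_lconst s (v : lpoly V) :
  eval_Ndel (lsubst s (@lconst _ V) v) = lsubst s.[- 'X] id v.
Proof.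
rewrite /lsubst (big_morph _ eval_NdelD (id1 := 0)) ?/eval_Ndel ?lsubst0 //.
apply: eq_bigr => n _.
by rewrite -/eval_Ndel eval_NdelZ eval_Ndel_lconst horner_exp.
Qed.
End CoefficientwiseMaps.

(** Eliminate Y between the first two relations, using
    (d + l) ^ 2 - d ^ 2 = l (l + 2 d). *)
Lemma lmodule_elimination (B : comNzRingType) (W : lmodType B) (d l : B)
    (X Y T1 Tm T : W) :
  (d + l) *: Y = T1 + d *: X -> (d + l) *: X = Tm + d *: Y ->
  d *: T1 + (d + l) *: Tm = (l + (d + d)) *: T ->
  (l + (d + d)) *: (l *: X) = (l + (d + d)) *: T.
Proof.
move=> E1 E2 <-.
have -> : T1 = (d + l) *: Y - d *: X by rewrite E1 addrK.
have -> : Tm = (d + l) *: X - d *: Y by rewrite E2 addrK.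
rewrite !scalerBr !scalerA [d * (d + l)]mulrC [RHS]addrC [RHS]addrA subrK -scalerBl.
by congr (_ *: _); ring.
Qed.

Section LinearMaps.
Context (F : fieldType) (V : lmodType {poly F}) (f : V -> V).
Hypothesis fD : forall x y, f (x + y) = f x + f y.
Hypothesis fZ : forall p x, f (p *: x) = p *: f x.

Let f0 : f 0 = 0.
Proof. by rewrite -(scale0r 0) fZ !scale0r. Qed.

Lemma lmapD u v : lmap f (u + v) = lmap f u + lmap f v.
Proof. by apply: lsubstD => x y; rewrite fD lconstD. Qed.

Lemma lmapZ P u : lmap f (P *: u) = P *: lmap f u.
Proof.
apply/lpolyP => n; rewrite lmapE // !lscaleE (big_morph _ fD f0).
by apply: eq_bigr => i _; rewrite fZ lmapE.
Qed.

Lemma eval_Ndel_lmap u : eval_Ndel (lmap f u) = f (eval_Ndel u).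
Proof.
elim/lpoly_ind: u => [u v IHu IHv|p x].
  by rewrite lmapD !eval_NdelD IHu IHv fD.
rewrite lmapZ !eval_NdelZ fZ eval_Ndel_lconst; congr (_ *: _).
rewrite /lmap lsubst_monom ?expr0 ?scale1r ?eval_Ndel_lconst // => y z.
by rewrite fD lconstD.
Qed.
End LinearMaps.

(** * Derivations of a Lie conformal algebra *)

Section LieConformal.
Context (F : fieldType) (V : lieConformalType F).
Implicit Types (x y z : V) (D : V -> lpoly V).
Local Notation lam1 := (lam1 F).
Local Notation del1 := (del1 F).
Local Notation br := (@lbr F V).

Lemma br_addl x y z : br (x + y) z = br x z + br y z.
Proof. by have [+ _] := lbr_bilinear 1 x y z; rewrite !polyC1 !scale1r. Qed.

Lemma br_addr x y z : br z (x + y) = br z x + br z y.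
Proof. by have [_] := lbr_bilinear 1 x y z; rewrite !polyC1 !scale1r. Qed.

Lemma br_0l y : br 0 y = 0.
Proof. by apply: (@addrI _ (br 0 y)); rewrite -br_addl !addr0. Qed.

Lemma br_0r y : br y 0 = 0.
Proof. by apply: (@addrI _ (br y 0)); rewrite -br_addr !addr0. Qed.

Lemma br_constl (k : F) x y : br (k%:P *: x) y = k%:P%:P *: br x y.
Proof. by have [+ _] := lbr_bilinear k x 0 y; rewrite !addr0 br_0l addr0. Qed.

Lemma br_dell x y : br ('X *: x) y = - 'X *: br x y.
Proof. by case: (lbr_sesquilinear x y). Qed.

Lemma br_oppl x y : br (- x) y = - br x y.
Proof. by apply/eqP; rewrite -addr_eq0 -br_addl addNr br_0l. Qed.

Lemma br_suml I (r : seq I) (f : I -> V) y :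
  br (\sum_(i <- r) f i) y = \sum_(i <- r) br (f i) y.
Proof.
exact: (big_morph (fun x => br x y) (fun u v => br_addl u v y) (br_0l y)).
Qed.

(** The 0-th product x_(0) y. *)
Definition zprod x y : V := lcoef (br x y) 0%N.

Lemma zprod_addr x y z : zprod z (x + y) = zprod z x + zprod z y.
Proof. by rewrite /zprod br_addr lcoefD. Qed.

Lemma zprod_addl x y z : zprod (x + y) z = zprod x z + zprod y z.
Proof. by rewrite /zprod br_addl lcoefD. Qed.

Lemma zprod0r x : zprod x 0 = 0.
Proof. by rewrite /zprod br_0r lcoef0. Qed.

Lemma conformal_linearD D x y : conformal_linear D -> D (x + y) = D x + D y.
Proof. by case=> /(_ 1 x y) + _; rewrite polyC1 !scale1r. Qed.

Lemma conformal_linear0 D : conformal_linear D -> D 0 = 0.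
Proof.
by move=> DL; apply: (@addrI _ (D 0)); rewrite -(conformal_linearD _ _ DL) !addr0.
Qed.

Lemma conformal_linear_const D (k : F) x :
  conformal_linear D -> D (k%:P *: x) = k%:P%:P *: D x.
Proof.
move=> DL; have [/(_ k x 0) + _] := DL.
by rewrite !addr0 (conformal_linear0 DL) addr0.
Qed.

Lemma conformal_linear_del D x :
  conformal_linear D -> D ('X *: x) = (del1 + 'X) *: D x.
Proof. by move=> [_ DL]; apply: DL. Qed.

(** Left sesquilinearity: a power of lambda in front of [x _lambda y] can be
    moved onto x as a power of - del. *)
Lemma lsubst_br (u : lpoly V) y :
  lsubst lam1 (fun x => br x y) u = br (eval_Ndel u) y.
Proof.
rewrite /eval_Ndel /lsubst br_suml; apply: eq_bigr => n _.
elim: n (lcoef u n) => [|n IH] x; first by rewrite !expr0 !scale1r.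
rewrite [in RHS]exprSr -scalerA -IH scaleNr -scaleN1r -polyCN br_constl br_dell.
by rewrite !polyCN !polyC1 scaleN1r scaleNr opprK scalerA -exprSr.
Qed.

Lemma lcoef0_lconst2 (w : lpoly V) s :
  lcoef (lsubst s (fun z => lconst (lconst z)) w) 0%N =
    lsubst s`_0 (@lconst _ V) w.
Proof. by rewrite lcoef0_lsubst; apply: lsubst_ext => z; apply: lcoef_lconst0. Qed.

Lemma lam2_0 : (lam2 F)`_0 = lam1.
Proof. exact: coefC. Qed.

Lemma mu2_0 : (mu2 F)`_0 = 0.
Proof. exact: coefX. Qed.

(** The derivation rule at mu = 0.  The left bracket becomes an honest
    lambda-bracket because only lambda is left in it, so the commutator of D
    with x_(0) is inner. *)
Lemma derivation_at_mu0 D x y : conformal_derivation D ->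
  D (zprod x y) = br (eval_Ndel (D x)) y + lmap (zprod x) (D y).
Proof.
move=> [DL /(_ x y) /(congr1 (fun u => lcoef u 0%N)) E].
apply: (etrans _ (etrans E _)).
  apply/esym/(etrans (lcoef0_lsubst _ _ _)); rewrite mu2_0.
  apply: (etrans (lsubst_at0 _ _)).
    by rewrite (conformal_linear0 DL) lsubst0 ?lcoef0 // => u v; rewrite !lconstD.
  by apply: (etrans (lcoef0_lconst2 _ _)); rewrite lam2_0; apply: lmap_id.
apply: (etrans (lcoefD _ _ _)); congr (_ + _).
  apply: (etrans (lcoef0_lsubst _ _ _)); rewrite lam2_0 -lsubst_br.
  apply: lsubst_ext => u; apply: (etrans (lcoef0_lconst2 _ _)).
  by rewrite coefD lam2_0 mu2_0 addr0; apply: lmap_id.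
apply: (etrans (lcoef0_lsubst _ _ _)); rewrite lam2_0.
apply: lsubst_ext => v; apply: (etrans (lcoef0_lconst2 _ _)).
by rewrite mu2_0; apply: lsubst_at0; apply: monalgU0.
Qed.

(** Skew-symmetry substitutes - lambda - del for lambda, and this vanishes at
    lambda = - del. *)
Lemma eval_Ndel_br x y : eval_Ndel (br x y) = - zprod y x.
Proof.
rewrite lbr_skew -scaleN1r eval_NdelZ hornerN hornerC scaleN1r.
rewrite eval_Ndel_lsubst_lconst.
rewrite hornerD !hornerN hornerX hornerC opprK subrr lsubst_at0 //.
Qed.

(** The derivation rule for ad x is the Jacobi identity. *)
Lemma conformal_derivation_ad x : conformal_derivation (br x).
Proof.
split; last exact: (lbr_jacobi x).
split=> [k u v|v]; last by case: (lbr_sesquilinear x v).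
by case: (lbr_bilinear k u v x).
Qed.

(** The derivation rule is linear over polynomials in lambda, where lambda is
    not a zero divisor: a map that becomes inner after multiplication by lambda
    is a derivation.  This is how the outer derivation is recognized as one. *)
Lemma conformal_derivation_of_lam_ad D x :
  (forall v, 'X *: D v = br x v) -> conformal_derivation D.
Proof.
move=> lamD; have [[lin del] der] := conformal_derivation_ad x.
have cD (A : nzRingType) (W : lmodType A) (u v : W) := @lconstD A W u v.
have bD s : (forall u v y, bracket_at br s (u + v) y =
    bracket_at br s u y + bracket_at br s v y) /\
  (forall u v y, bracket_at br s y (u + v) =
    bracket_at br s y u + bracket_at br s y v).
  by split=> u v y; rewrite /bracket_at ?br_addl ?br_addr lsubstD // => ? ?;
    rewrite !cD.
split; first split.
- move=> k u v; apply: (@lscaleX_inj _ V); rewrite /= scalerDr scalerA.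
  by rewrite mulrC -scalerA !lamD lin.
- move=> v; apply: (@lscaleX_inj _ V); rewrite /= scalerA.
  by rewrite mulrC -scalerA !lamD del.
move=> y z.
have cc2D (u v : V) :
    lconst (lconst (u + v)) = lconst (lconst u) + lconst (lconst v).
  by rewrite !cD.
pose sub2 := lsubst (lam2 F) (fun z : V => lconst (lconst z)).
have EL : lsubst (mu2 F) (fun v => sub2 (br x v)) (br y z) =
    lam2 F *: lsubst (mu2 F) (fun v => sub2 (D v)) (br y z).
  rewrite scaler_sumr; apply: eq_bigr => n _.
  by rewrite -lamD /sub2 lsubst_scaleX // !scalerA mulrC.
have Er u w s : lsubst (lam2 F) (fun v => bracket_at br s u v) (br x w) =
    lam2 F *: lsubst (lam2 F) (fun v => bracket_at br s u v) (D w).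
  by rewrite -lamD; apply: lsubst_scaleX => u' v'; apply: (proj2 (bD s)).
have El u w s : lsubst (lam2 F) (fun v => bracket_at br s v u) (br x w) =
    lam2 F *: lsubst (lam2 F) (fun v => bracket_at br s v u) (D w).
  by rewrite -lamD; apply: lsubst_scaleX => u' v'; apply: (proj1 (bD s)).
have lam2_inj : injective (fun u : lpoly (lpoly V) => lam2 F *: u).
  exact: lscaleC_inj (@lscaleX_inj _ V).
apply: lam2_inj; rewrite /= scalerDr.
apply: (etrans (esym EL)); apply: (etrans (der y z)).
by congr (_ + _); [apply: El | apply: Er].
Qed.
End LieConformal.

Section ConformalLinear.
Context (F : fieldType) (V : lieConformalType F).

Lemma conformal_linearZ (D : V -> lpoly V) p x : conformal_linear D ->
  D (p *: x) = peval p (del1 F + 'X) *: D x.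
Proof.
move=> DL; elim/poly_ind: p x => [|p k IH] x.
  by rewrite /peval rmorph0 horner0 !scale0r (conformal_linear0 DL).
rewrite scalerDl (conformal_linearD _ _ DL) -scalerA IH (conformal_linear_del _ DL).
rewrite (conformal_linear_const _ _ DL) scalerA.
by rewrite pevalD pevalM pevalX pevalC scalerDl.
Qed.
End ConformalLinear.

(** * Derivations of CW(a, c) become inner after multiplication by lambda *)

Section CW.
Context (F : fieldType) (a c : F).
Local Notation CW := (CW a c).
Local Notation L := (Lgen a c).
Local Notation lam1 := (lam1 F).
Local Notation del1 := (del1 F).
Local Notation br := (@lbr F CW).
Implicit Types x y v : CW.

(** The F[del]-linear map L_i |-> L_(i + n), through which L_n acts by the 0-th
    product. *)
Definition shift (n : int) (x : CW) : CW := \sum_(i <- msupp x) mkmalgU (i + n) x@_i.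

Lemma shiftD n x y : shift n (x + y) = shift n x + shift n y.
Proof.
apply: (malg_sumD (G := fun i p => mkmalgU (i + n) p : CW)) => i p q.
exact: monalgUD.
Qed.

Lemma shiftU n i p : shift n (p *: L i) = p *: L (i + n).
Proof.
rewrite -!CW_U; apply: (malg_sumU (G := fun i p => mkmalgU (i + n) p : CW)).
by move=> j q r; apply: monalgUD.
Qed.

Lemma shift_gen n i : shift n (L i) = L (i + n).
Proof. by rewrite -[L i]scale1r shiftU scale1r. Qed.

Lemma shiftZ n p x : shift n (p *: x) = p *: shift n x.
Proof.
elim/CW_ind: x => [x y IHx IHy|i q]; last by rewrite scalerA !shiftU scalerA.
by rewrite scalerDr !shiftD IHx IHy scalerDr.
Qed.

Lemma shiftN n x : shift n (- x) = - shift n x.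
Proof. by rewrite -scaleN1r shiftZ scaleN1r. Qed.

Lemma shift_shift n m x : shift n (shift m x) = shift (m + n) x.
Proof.
elim/CW_ind: x => [x y IHx IHy|i q]; first by rewrite !shiftD IHx IHy.
by rewrite !shiftU addrA.
Qed.

Lemma shift0 x : shift 0 x = x.
Proof.
elim/CW_ind: x => [x y IHx IHy|i q]; first by rewrite !shiftD IHx IHy.
by rewrite !shiftU addr0.
Qed.

Lemma shiftK n x : shift (- n) (shift n x) = x.
Proof. by rewrite shift_shift addrN shift0. Qed.

Lemma shiftVK n x : shift n (shift (- n) x) = x.
Proof. by rewrite shift_shift addNr shift0. Qed.

Lemma CW_scaler_inj (p : {poly F}) : p != 0 -> injective (fun x : CW => p *: x).
Proof.
move=> p0 x y /= xy; apply/malgP => i; apply: (mulfI p0).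
by have := congr1 (mcoeff i) xy; rewrite /= !mcoeffZ.
Qed.

Lemma br_gen i j p q : br (p *: L i) (q *: L j) =
  (peval p (- lam1) * peval q (del1 + lam1) * CW_coef a c i j) *: lconst (L (i + j)).
Proof. exact: CW_brU. Qed.

Lemma br_scaler p x y : br x (p *: y) = peval p (del1 + lam1) *: br x y.
Proof. exact: CW_brZr. Qed.

Lemma peval_coef0 (p : {poly F}) (s : {poly {poly F}}) :
  (peval p s)`_0 = p \Po s`_0.
Proof.
elim/poly_ind: p => [|p k IH].
  by rewrite /peval rmorph0 horner0 coef0 comp_poly0.
rewrite pevalD pevalM pevalX pevalC coefD coef0M IH coefC.
by rewrite comp_polyD comp_polyM comp_polyX comp_polyC.
Qed.

Lemma del1_coef0 : del1`_0 = 'X.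
Proof. exact: coefC. Qed.

Lemma lam1_coef0 : lam1`_0 = 0.
Proof. exact: coefX. Qed.

Lemma peval1 (s : {poly {poly F}}) : peval 1 s = 1.
Proof. by rewrite -polyC1 pevalC !polyC1. Qed.

Lemma zprod_genU i j p q : zprod (p *: L i) (q *: L j) =
  (p.[0]%:P * q * ((a * i%:~R + c)%:P * 'X)) *: L (i + j).
Proof.
rewrite /zprod br_gen lscale_coef0 lcoef_lconst0; congr (_ *: _).
rewrite !coef0M !peval_coef0 coefN coefD del1_coef0 lam1_coef0.
rewrite oppr0 addr0 comp_polyXr comp_poly0r horner_coef0.
by rewrite /CW_coef coefD !coef0M del1_coef0 lam1_coef0 !coefC mulr0 addr0.
Qed.

Lemma zprod_gen i y :
  zprod (L i) y = (a * i%:~R + c)%:P *: ('X *: shift i y).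
Proof.
elim/CW_ind: y => [x y IHx IHy|j q].
  by rewrite zprod_addr IHx IHy shiftD !scalerDr.
rewrite -[L i]scale1r zprod_genU shiftU !scalerA hornerC mul1r [j + i]addrC.
by congr (_ *: _); ring.
Qed.

Lemma zprod_coef x i j :
  (zprod x (L j))@_(i + j) = (x@_i).[0]%:P * ((a * i%:~R + c)%:P * 'X).
Proof.
elim/CW_ind: x => [x y IHx IHy|k p].
  have -> : (x + y)@_i = x@_i + y@_i by apply: mcoeffD.
  rewrite zprod_addl; apply: (etrans (mcoeffD _ _ _)).
  apply: (etrans (congr2 +%R IHx IHy)); rewrite -mulrDl hornerD.
  by congr (_ * _); apply/esym/polyCD.
rewrite -[L j]scale1r zprod_genU mulr1 -!CW_U !mcoeffU (inj_eq (addIr j)).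
by case: eqP => [->|_]; rewrite ?mulr1n // mulr0n horner0 mul0r.
Qed.

Lemma lmap_zprod_gen i (u : lpoly CW) :
  lmap (zprod (L i)) u = (a * i%:~R + c)%:P%:P *: (del1 *: lmap (shift i) u).
Proof.
apply/lpolyP => n; rewrite lmapE ?zprod0r // lscaleC_coef.
rewrite lscaleC_coef zprod_gen lmapE //.
by rewrite -(scale0r 0) shiftZ !scale0r.
Qed.

(** The rule at mu = 0 for x = L_i, where x_(0) is (a i + c) del times a shift.
    Every derivation is governed by these relations for a few values of i. *)
Lemma derivation_shift D i v : conformal_derivation D ->
  (a * i%:~R + c)%:P%:P *: ((del1 + lam1) *: D (shift i v)) =
  br (eval_Ndel (D (L i))) v +
    (a * i%:~R + c)%:P%:P *: (del1 *: lmap (shift i) (D v)).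
Proof.
move=> Dder; have [DL _] := Dder.
rewrite -lmap_zprod_gen -(derivation_at_mu0 _ _ Dder) zprod_gen.
by rewrite (conformal_linear_const _ _ DL) (conformal_linear_del _ DL).
Qed.

(** For c != 0, the element L_0 acts by c del, so that the two occurrences of
    D v in the rule at mu = 0 differ by c lambda D v. *)
Lemma derivation_lam_ad_c_neq0 D : c != 0 -> conformal_derivation D ->
  exists x, forall v, 'X *: D v = br x v.
Proof.
move=> c0 Dder; exists (c^-1%:P *: eval_Ndel (D (L 0))) => v; rewrite br_constl.
have := derivation_shift 0 v Dder; rewrite shift0 mulr0 add0r.
have -> : lmap (shift 0) (D v) = D v.
  by apply/lpolyP => n; rewrite lmapE shift0.
rewrite scalerDl scalerDr addrC => /addIr <-.
by rewrite scalerA -!polyCM mulVf // scale1r.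
Qed.

Lemma CW_coef_c0 i j : c = 0 ->
  CW_coef a c i j = a%:P%:P * (i%:~R * del1 + (i + j)%:~R * lam1).
Proof.
move=> c0; rewrite /CW_coef c0 mulr0 !addr0 !(polyCM a) !(polyCM a%:P).
by rewrite !(rmorph_int polyC) mulrDr !mulrA.
Qed.

(** On y = L_m this is the identity
    del ((m + 1) del + (m + 1 + j) lambda)
      + (del + lambda) ((m - 1) del + (m + j) lambda)
    = (lambda + 2 del) (m del + (m + j) lambda). *)
Lemma br_shift_identity y j : c = 0 ->
  del1 *: lmap (shift (-1)) (br (shift 1 y) (L j)) +
    (del1 + lam1) *: br (shift (-1) y) (L (j + 1)) =
  (lam1 + (del1 + del1)) *: br y (L j).
Proof.
move=> c0; elim/CW_ind: y => [x y IHx IHy|m p].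
  rewrite !shiftD !br_addl (lmapD (shiftD (-1))) !scalerDr -IHx -IHy.
  by rewrite addrACA.
rewrite !shiftU -[L j]scale1r -[L (j + 1)]scale1r !br_gen.
rewrite (lmapZ (shiftD (-1)) (shiftZ (-1))).
have -> : lmap (shift (-1)) (lconst (L (m + 1 + j))) = lconst (L (m + j)).
  rewrite /lmap lsubst_monom ?expr0 ?scale1r ?shift_gen.
    by rewrite addrAC addrK.
  by move=> u v; rewrite shiftD lconstD.
have -> : L (m - 1 + (j + 1)) = L (m + j) by congr L; rewrite addrACA addNr addr0.
rewrite !scalerA -scalerDl; congr (_ *: _).
rewrite !CW_coef_c0 // !intrD mulrNz peval1.
move: (peval p _) => P; move: (a%:P%:P) (m%:~R) (j%:~R) del1 lam1 => e m' j' d l.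
ring.
Qed.

(** Specializing the rule at mu = 0 to lambda = - del kills its left-hand
    side. *)
Lemma eval_Ndel_derivation D i v : conformal_derivation D ->
  zprod v (eval_Ndel (D (L i))) =
    (a * i%:~R + c)%:P *: ('X *: shift i (eval_Ndel (D v))).
Proof.
move=> Dder; have := congr1 eval_Ndel (derivation_shift i v Dder).
have evalC p (u : lpoly CW) : eval_Ndel (p%:P *: u) = p *: eval_Ndel u.
  by rewrite eval_NdelZ hornerC.
have eval_del1 (u : lpoly CW) : eval_Ndel (del1 *: u) = 'X *: eval_Ndel u.
  exact: evalC.
have eval_dl (u : lpoly CW) : eval_Ndel ((del1 + lam1) *: u) = 0.
  by rewrite eval_NdelZ hornerD hornerC hornerX subrr scale0r.
rewrite evalC eval_dl scaler0 eval_NdelD eval_Ndel_br evalC eval_del1.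
rewrite (eval_Ndel_lmap (shiftD i) (shiftZ i)) => /eqP.
by rewrite eq_sym addrC subr_eq0 => /eqP.
Qed.

(** The preceding relation for i = 1 and v = L_(-1), where both 0-th products
    are a del times a shift, up to sign. *)
Lemma eval_Ndel_derivation_c0 D : c = 0 -> a != 0 -> conformal_derivation D ->
  eval_Ndel (D (L (-1))) = - shift (-1) (shift (-1) (eval_Ndel (D (L 1)))).
Proof.
move=> c0 a0 Dder; have := eval_Ndel_derivation 1 (L (-1)) Dder.
rewrite zprod_gen c0 mulr1 mulrN1 !addr0 polyCN scaleNr -scalerN.
have aP0 : a%:P != 0 by rewrite polyC_eq0.
move/(CW_scaler_inj aP0); rewrite -scalerN.
move/(CW_scaler_inj (negbT (polyX_eq0 F))) => key.
apply: (etrans (esym (shiftK 1 _))).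
apply: (etrans (congr1 (shift (-1)) (esym key))).
exact: shiftN.
Qed.

Lemma derivation_shift_div D i z v : conformal_derivation D ->
  a * i%:~R + c != 0 -> eval_Ndel (D (L i)) = (a * i%:~R + c)%:P *: z ->
  (del1 + lam1) *: D (shift i v) = br z v + del1 *: lmap (shift i) (D v).
Proof.
move=> Dder k0 zE; have := derivation_shift i v Dder; rewrite zE br_constl.
move: (_ + c) k0 => k k0; rewrite -scalerDr; apply: lscaleC_inj.
by apply: CW_scaler_inj; rewrite polyC_eq0.
Qed.

Lemma lmap_shiftK n (u : lpoly CW) : lmap (shift (- n)) (lmap (shift n) u) = u.
Proof.
have s0 m : shift m 0 = 0 by rewrite -(scale0r 0) shiftZ !scale0r.
by apply/lpolyP => m; rewrite !lmapE // shiftK.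
Qed.

(** For c = 0, L_0 acts trivially by the 0-th product, and L_1 and L_(-1) replace
    it: each gives a relation between D L_j and D L_(j + 1), and eliminating the
    latter leaves lambda (lambda + 2 del) D L_j. *)
Lemma derivation_lam_ad_c_eq0 D : c = 0 -> a != 0 -> conformal_derivation D ->
  exists x, forall v, 'X *: D v = br x v.
Proof.
move=> c0 a0 Dder; have [DL _] := Dder.
have xm := eval_Ndel_derivation_c0 c0 a0 Dder.
have [y yE] : exists y, a%:P *: y = shift (-1) (eval_Ndel (D (L 1))).
  exists (a^-1%:P *: shift (-1) (eval_Ndel (D (L 1)))).
  by rewrite scalerA -polyCM divff // scale1r.
exists y.
have k1 : a * 1%:~R + c = a by rewrite c0 mulr1 addr0.
have km : a * (-1)%:~R + c = - a by rewrite c0 mulrN1 addr0.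
have x1E : eval_Ndel (D (L 1)) = a%:P *: shift 1 y.
  by rewrite -shiftZ yE; apply/esym; apply: (shiftVK 1).
have xmE : eval_Ndel (D (L (-1))) = (- a)%:P *: shift (-1) y.
  by apply: (etrans xm); rewrite polyCN scaleNr -shiftZ yE.
have gen j : lam1 *: D (L j) = br y (L j).
  have := @derivation_shift_div D 1 (shift 1 y) (L j) Dder.
  have := @derivation_shift_div D (-1) (shift (-1) y) (L (j + 1)) Dder.
  have -> : shift (-1) (L (j + 1)) = L j by rewrite shift_gen addrK.
  rewrite shift_gen k1 km oppr_eq0 => /(_ a0 xmE) Em /(_ a0 x1E) E1.
  have {}E1 : (del1 + lam1) *: lmap (shift (-1)) (D (L (j + 1))) =
      lmap (shift (-1)) (br (shift 1 y) (L j)) + del1 *: D (L j).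
    rewrite -(lmapZ (shiftD (-1)) (shiftZ (-1))) E1.
    rewrite (lmapD (shiftD (-1))) (lmapZ (shiftD (-1)) (shiftZ (-1))).
    by congr (_ + _ *: _); apply: (lmap_shiftK 1).
  have := lmodule_elimination E1 Em (br_shift_identity y j c0).
  have -> : lam1 + (del1 + del1) = 'X + ('X + 'X : {poly F})%:P by rewrite polyCD.
  exact: lscale_linear_inj.
elim/CW_ind => [u v IHu IHv|j p].
  by rewrite (conformal_linearD _ _ DL) br_addr scalerDr IHu IHv.
by rewrite (conformal_linearZ _ _ DL) br_scaler -gen !scalerA mulrC.
Qed.
End CW.

(** * Dividing by lambda *)

Section ConstantTerms.
Context (F : fieldType) (a c : F).
Local Notation CW := (CW a c).
Local Notation L := (Lgen a c).
Local Notation br := (@lbr F CW).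
Implicit Types x y v : CW.

Lemma CW_split_const x : exists x0 q,
  x = x0 + 'X *: q /\ forall i, x0@_i = ((x@_i).[0])%:P.
Proof.
elim/CW_ind: x => [x y [x0 [q [xE x0E]]] [y0 [r [yE y0E]]]|i p].
  exists (x0 + y0), (q + r); split=> [|i].
    by rewrite scalerDr addrACA -xE -yE.
  have -> : (x + y)@_i = x@_i + y@_i by apply: mcoeffD.
  by apply: (etrans (mcoeffD _ _ _)); rewrite x0E y0E hornerD polyCD.
elim/poly_ind: p => [|p k _].
  exists 0, 0; rewrite scaler0 addr0 scale0r; split=> // j.
  have -> : (0 : CW)@_j = 0 by apply: mcoeff0.
  by rewrite horner0.
exists (k%:P *: L i), (p *: L i); split=> [|j].
  by rewrite scalerA -scalerDl addrC mulrC.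
rewrite -!CW_U !mcoeffU; case: eqP => _; last by rewrite !mulr0n horner0.
by rewrite !mulr1n hornerMXaddC mulr0 add0r.
Qed.

(** The coefficient of L_m modulo del is the only obstruction to divisibility by
    del. *)
Lemma CW_split_const_at m x : (forall i, i != m -> (x@_i).[0] = 0) ->
  exists q, x = ((x@_m).[0])%:P *: L m + 'X *: q.
Proof.
move=> x0; have [y [q [xE yE]]] := CW_split_const x.
exists q; rewrite {1}xE; congr (_ + _); apply/malgP => i.
rewrite yE -CW_U mcoeffU eq_sym; case: eqP => [->|/eqP im]; first by rewrite mulr1n.
by rewrite x0 // mulr0n.
Qed.

(** At lambda = 0 the hypothesis gives x_(0) v = 0; take v = L_0. *)
Lemma const_term_eq0_of_lam_ad (D : CW -> lpoly CW) x i :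
  (forall v, 'X *: D v = br x v) -> a * i%:~R + c != 0 -> (x@_i).[0] = 0.
Proof.
move=> lamD k0; have z : zprod x (L 0) = 0.
  by rewrite /zprod -lamD lscale_coef0 coefX scale0r.
have := zprod_coef x i 0; rewrite z => /esym E.
have {}E : ((x@_i).[0])%:P * ((a * i%:~R + c)%:P * 'X) = 0.
  by apply: (etrans E); apply: mcoeff0.
by apply/eqP; move/eqP: E; rewrite !mulf_eq0 !polyC_eq0 (negPf k0) polyX_eq0 !orbF.
Qed.

Lemma CInn_sub_CDer : (CInn CW `<=` CDer CW)%classic.
Proof. by move=> _ [x ->]; apply: conformal_derivation_ad. Qed.

Lemma derivation_lam_ad D : (a, c) != (0, 0) -> conformal_derivation D ->
  exists x, forall v, 'X *: D v = br x v.
Proof.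
move=> ac0 Dder; have [c0|c0] := eqVneq c 0.
  apply: (derivation_lam_ad_c_eq0 c0 _ Dder).
  by apply: contraNneq ac0 => ->; rewrite c0.
exact: derivation_lam_ad_c_neq0 c0 Dder.
Qed.

(** Here x is divisible by del, x = del q, and [del q _lambda v] is
    - lambda [q _lambda v], so lambda cancels. *)
Lemma CDer_eq_CInn : (a, c) != (0, 0) ->
  (forall i : int, a * i%:~R + c != 0) -> CDer CW = CInn CW.
Proof.
move=> ac0 k0; apply/seteqP; split; last exact: CInn_sub_CDer.
move=> D Dder; have [x lamD] := derivation_lam_ad ac0 Dder.
have x0 i := const_term_eq0_of_lam_ad lamD (k0 i).
have [q xE] := @CW_split_const_at 0 x (fun i _ => x0 i).
exists (- q); apply/funext => v; apply: (@lscaleX_inj _ CW) => /=.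
by rewrite lamD {1}xE x0 polyC0 scale0r add0r br_dell br_oppl scalerN scaleNr.
Qed.

Lemma conf_ext_gen f i p : conf_ext f (p *: L i) = peval p (del1 F + lam1 F) *: f i.
Proof.
rewrite -CW_U.
apply: (malg_sumU (G := fun i p => peval p (del1 F + lam1 F) *: f i)) => j q r.
by rewrite pevalD scalerDl.
Qed.

Lemma conf_extD (f : int -> lpoly CW) x y :
  conf_ext f (x + y) = conf_ext f x + conf_ext f y.
Proof.
apply: (malg_sumD (G := fun i p => peval p (del1 F + lam1 F) *: f i)) => j q r.
by rewrite pevalD scalerDl.
Qed.
End ConstantTerms.

(** * The outer derivation *)

Section OuterDerivation.
Context (F : numFieldType) (a c : F) (n : int).
Hypotheses (a0 : a != 0) (cE : c = a * n%:~R).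
Local Notation CW := (CW a c).
Local Notation L := (Lgen a c).
Local Notation br := (@lbr F CW).
Local Notation calD := (@calD F a c n).

(** The scalar by which the normalization of calD differs from
    [L_(- n) _lambda v] / lambda. *)
Definition calD_unit : F := if c == 0 then a else c.

Lemma calD_unit_neq0 : calD_unit != 0.
Proof. by rewrite /calD_unit; case: (eqVneq c 0). Qed.

(** Among the L_i, only L_(- n) acts trivially by the 0-th product. *)
Lemma weight_eq0 i : (a * i%:~R + c == 0) = (i == - n).
Proof.
rewrite cE -mulrDr mulf_eq0 (negPf a0) -intrD intr_eq0 /=.
by rewrite addr_eq0.
Qed.

Lemma c_eq0 : (c == 0) = (n == 0).
Proof. by rewrite cE mulf_eq0 (negPf a0) intr_eq0. Qed.

Lemma calD_gen p j : calD (p *: L j) = peval p (del1 F + lam1 F) *: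
  (((a * j%:~R + c) / calD_unit)%:P%:P *: lconst (L (j - n))).
Proof.
rewrite /calD conf_ext_gen /calD_unit; congr (_ *: _).
have [c0|c0] := eqVneq c 0; rewrite lconstZ.
  have n0 : n = 0 by apply/eqP; rewrite -c_eq0 c0.
  have -> : (a * j%:~R + c) / a = j%:~R by rewrite c0 addr0 mulrC mulKf.
  by have -> : j - n = j by rewrite n0 subr0.
have -> // : (a * j%:~R + c) / c = 1 + a / c * j%:~R.
by rewrite mulrDl divff // addrC mulrAC.
Qed.

(** [L_(- n) _lambda L_j] has no del-term, hence is a multiple of lambda. *)
Lemma lam_calD v : calD_unit%:P%:P *: ('X *: calD v) = br (L (- n)) v.
Proof.
elim/CW_ind: v => [u v IHu IHv|j p].
  by rewrite br_addr -IHu -IHv /calD conf_extD !scalerDr.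
rewrite calD_gen -[L (- n)]scale1r br_gen peval1 mul1r !scalerA addrC.
congr (_ *: _); last by congr (lconst (L _)); rewrite addrC.
rewrite /CW_coef.
have -> : a * (- n)%:~R + c = 0 by apply/eqP; rewrite weight_eq0.
have -> : a * (- n + j)%:~R + 2 * c = a * j%:~R + c.
  by rewrite cE intrD mulrNz; ring.
rewrite !polyC0 mul0r add0r.
have -> : (a * j%:~R + c) = (a * j%:~R + c) / calD_unit * calD_unit.
  by rewrite divfK // calD_unit_neq0.
rewrite mulfK ?calD_unit_neq0 // !(polyCM _ calD_unit) !(polyCM _ calD_unit%:P).
by rewrite /lam1; ring.
Qed.

Lemma lam_scale_calD k v :
  'X *: (k%:P%:P *: calD v) = (k / calD_unit)%:P%:P *: br (L (- n)) v.
Proof.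
rewrite -lam_calD [RHS]scalerA -!polyCM divfK ?calD_unit_neq0 // !scalerA.
by rewrite mulrC.
Qed.

(** At lambda = 0, the value at L_j of an inner derivation has no component along
    L_(j - n), whereas that of calD has one for some j: the sum is direct. *)
Lemma CDer_direct_sum : is_direct_sum (CDer CW) (CInn CW) (Cline calD).
Proof.
have k0 := calD_unit_neq0.
have ac0 : (a, c) != (0, 0) by rewrite xpair_eqE negb_and a0.
split; apply/seteqP; split.
- move=> D Dder; have [x lamD] := derivation_lam_ad ac0 Dder.
  have x0 i : i != - n -> (x@_i).[0] = 0.
    by move=> ni; apply: (const_term_eq0_of_lam_ad lamD); rewrite weight_eq0.
  have [q xE] := CW_split_const_at x0; move: (_.[0]) xE => k xE.
  exists (br (- q)); first by exists (- q).
  exists (fun v => (k * calD_unit)%:P%:P *: calD v).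
    by exists (k * calD_unit).
  apply/funext => v; apply: (@lscaleX_inj _ CW); rewrite /= lamD xE.
  rewrite br_addl br_constl br_dell br_oppl scalerDr scalerN scaleNr.
  by rewrite lam_scale_calD mulfK // addrC.
- move=> _ [_ [y ->]] [_ [k _ <-]] <-.
  apply: (@conformal_derivation_of_lam_ad _ _ _
    (- ('X *: y) + (k / calD_unit)%:P *: L (- n))) => v.
  rewrite /= scalerDr br_addl br_oppl br_dell scaleNr opprK br_constl.
  by rewrite lam_scale_calD.
- move=> D [[y DE] [k _ kE]]; suff k00 : k = 0.
    by rewrite -kE k00; apply/funext => v; rewrite !polyC0 scale0r.
  (* calD maps L_0 to L_(- n) if c != 0; if c = 0 it kills L_0 and fixes L_1. *)
  pose j : int := if c == 0 then 1 else 0.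
  have E : k%:P *: lcoef (calD (L j)) 0%N = zprod y (L j).
    by rewrite /zprod -DE -kE lscaleC_coef.
  have {E} := congr1 (mcoeff (- n + j)) E; rewrite zprod_coef.
  have /eqP -> : a * (- n)%:~R + c == 0 by rewrite weight_eq0.
  rewrite polyC0 mul0r mulr0.
  have -> : lcoef (calD (L j)) 0%N = L (- n + j).
    rewrite -[L j]scale1r calD_gen peval1 scale1r lscaleC_coef lcoef_lconst0.
    rewrite [j - n]addrC; set u := _ / _; suff -> : u = 1 by rewrite scale1r.
    rewrite /u /j /calD_unit; case: (eqVneq c 0) => [->|c0'].
      by rewrite mulr1 addr0 divff.
    by rewrite mulr0 add0r divff.
  rewrite -CW_U mcoeffUU => /eqP.
  by rewrite polyC_eq0 => /eqP.
- move=> _ ->; split; first by exists 0; apply/funext => v; rewrite br_0l.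
  by exists 0 => //; apply/funext => v; rewrite !polyC0 scale0r.
Qed.
End OuterDerivation.

Theorem theorem3p2 (R : realType) (a c : R[i]) (ac_neq0 : (a, c) != (0, 0)) :
  (a = 0 \/ ~ (exists n : int, a^-1 * c = n%:~R) ->
     CDer (CW a c) = CInn (CW a c)) /\
  (forall n : int, a <> 0 -> a^-1 * c = n%:~R ->
     is_direct_sum (CDer (CW a c)) (CInn (CW a c)) (Cline (@calD _ a c n))).
Proof.
split=> [h|n /eqP a0 cE]; last by apply: CDer_direct_sum; rewrite // -cE mulVKf.
apply: CDer_eq_CInn => // i; case: (eqVneq a 0) => [az|a0].
  by move: ac_neq0; rewrite az mul0r add0r xpair_eqE eqxx.
case: h => [az|h]; first by rewrite az eqxx in a0.
apply/negP; rewrite addrC addr_eq0 => /eqP cE; apply: h; exists (- i).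
by rewrite cE mulrN mulKf // mulrNz.
Qed.
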